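(* Let $G$ be one of the four groups $\mathfrak J$, $\mathfrak{GS}$, $\mathfrak{FG}$, $\mathfrak H$ defined below. Every finitely presented group admitting an epimorphism onto $G$ is large.
   Context: For a finite alphabet $X$, $X^*$ denotes the rooted tree of finite words. Notation $g=(g_0,\dots,g_{d-1})\tau$ means the tree automorphism $g(xw)=\tau(x)\,g_x(w)$ for $x\in X=\{0,\dots,d-1\}$, $w\in X^*$, with $\tau$ a permutation of $X$ (omitted if trivial); these recursions define automorphisms uniquely. $\mathfrak J=\operatorname{IMG}(z^2+i)$: $d=2$, generated by $a=(1,1)\tau$, $b=(a,c)$, $c=(b,1)$, $\tau$ the transposition of $\{0,1\}$. Gupta–Sidki group $\mathfrak{GS}$: $d=3$, generated by $a=(1,1,1)\tau$, $b=(a,a^{-1},b)$, $\tau$ the cyclic permutation $0\mapsto1\mapsto2\mapsto0$. Fabrykowski–Gupta group $\mathfrak{FG}$: $d=3$, generated by $a=(1,1,1)\tau$, $b=(a,1,b)$, same $\tau$. Hanoi Towers group $\mathfrak H$: $d=3$, generated by $a=(a,1,1)\tau_{12}$, $b=(1,b,1)\tau_{02}$, $c=(1,1,c)\tau_{01}$, where $\tau_{ij}$ is the transposition of $i$ and $j$. A group is large if it has a finite-index subgroup admitting an epimorphism onto a non-abelian free group. *)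

(* Defs.v *)
From mathcomp Require Import all_boot all_fingroup.
Set Implicit Arguments. Unset Strict Implicit. Unset Printing Implicit Defensive.

Record Grp := {
  carrier :> Type;
  gop : carrier -> carrier -> carrier;
  ginv : carrier -> carrier;
  gunit : carrier;
  gopA : forall x y z, gop x (gop y z) = gop (gop x y) z;
  gop1l : forall x, gop gunit x = x;
  gop1r : forall x, gop x gunit = x;
  ginvl : forall x, gop (ginv x) x = gunit;
  ginvr : forall x, gop x (ginv x) = gunit }.
Arguments gop {_}. Arguments ginv {_}. Arguments gunit {_}.

Definition is_hom (G H : Grp) (f : G -> H) : Prop :=
  forall x y, f (gop x y) = gop (f x) (f y).

Definition is_subgroup (G : Grp) (S : G -> Prop) : Prop :=
  [/\ S gunit, (forall x y, S x -> S y -> S (gop x y)) & (forall x, S x -> S (ginv x))].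

Definition finite_index (G : Grp) (S : G -> Prop) : Prop :=
  exists (m : nat) (r : 'I_m -> G), forall x, exists i, S (gop (ginv (r i)) x).

Definition is_free_on (F : Grp) (I : Type) (b : I -> F) : Prop :=
  forall (H : Grp) (g : I -> H),
    exists phi : F -> H,
      [/\ is_hom phi, (forall i, phi (b i) = g i) &
          (forall psi : F -> H, is_hom psi -> (forall i, psi (b i) = g i) ->
                                forall x, psi x = phi x)].

Inductive normal_closure (F : Grp) (m : nat) (R : 'I_m -> F) : F -> Prop :=
  | nc_rel i : normal_closure R (R i)
  | nc_unit : normal_closure R gunit
  | nc_mul x y : normal_closure R x -> normal_closure R y -> normal_closure R (gop x y)
  | nc_inv x : normal_closure R x -> normal_closure R (ginv x)
  | nc_conj x g : normal_closure R x -> normal_closure R (gop (ginv g) (gop x g)).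

Definition finitely_presented (G : Grp) : Prop :=
  exists (n : nat) (F : Grp) (b : 'I_n -> F) (pi : F -> G) (m : nat) (R : 'I_m -> F),
    [/\ is_free_on b, is_hom pi, (forall y, exists x, pi x = y) &
        (forall x, pi x = gunit <-> normal_closure R x)].

Definition large (G : Grp) : Prop :=
  exists S : G -> Prop,
    [/\ is_subgroup S, finite_index S &
      exists (F : Grp) (I : Type) (b : I -> F) (f : G -> F),
        [/\ is_free_on b, (exists i j : I, i <> j),
            (forall x y, S x -> S y -> f (gop x y) = gop (f x) (f y)) &
            (forall z, exists x, S x /\ f x = z)]].

(* g = (g_0,...,g_{d-1}) tau :  g(x w) = tau(x) g_x(w)                      *)
Record tree_automaton := {
  deg : nat;
  state : Type;
  tau : state -> {perm 'I_deg};
  sect : state -> 'I_deg -> state;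
  gen : Type;
  gen_state : gen -> state }.

Section Action.
Variable A : tree_automaton.

Fixpoint act (q : state A) (w : seq 'I_(deg A)) : seq 'I_(deg A) :=
  match w with
  | [::] => [::]
  | x :: w' => tau q x :: act (sect q x) w'
  end.

Fixpoint act_inv (q : state A) (w : seq 'I_(deg A)) : seq 'I_(deg A) :=
  match w with
  | [::] => [::]
  | y :: w' => let x := ((tau q)^-1)%g y in x :: act_inv (sect q x) w'
  end.

Definition act_letter (l : gen A * bool) : seq 'I_(deg A) -> seq 'I_(deg A) :=
  if l.2 then act_inv (gen_state l.1) else act (gen_state l.1).

Fixpoint eval_word (ls : seq (gen A * bool)) : seq 'I_(deg A) -> seq 'I_(deg A) :=
  match ls with
  | [::] => id
  | l :: ls' => fun w => act_letter l (eval_word ls' w)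
  end.

Definition in_group (h : seq 'I_(deg A) -> seq 'I_(deg A)) : Prop :=
  exists ls, h =1 eval_word ls.
End Action.

Definition epi_onto (G : Grp) (A : tree_automaton) : Prop :=
  exists f : G -> (seq 'I_(deg A) -> seq 'I_(deg A)),
    [/\ (forall x y, f (gop x y) =1 (fun w => f x (f y w))),
        (forall x, in_group (f x)) &
        (forall h, in_group h -> exists x, f x =1 h)].

Definition tau01 : {perm 'I_2} := tperm ord0 (inord 1).
Definition tau_cyc : {perm 'I_3} := perm (@ordS_inj 3).
Definition t12 : {perm 'I_3} := tperm (inord 1) (inord 2).
Definition t02 : {perm 'I_3} := tperm ord0 (inord 2).
Definition t01 : {perm 'I_3} := tperm ord0 (inord 1).

(* IMG(z^2+i): a=(1,1)tau, b=(a,c), c=(b,1) *)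
Inductive J_st := J1 | Ja | Jb | Jc.
Inductive J_gen := Jga | Jgb | Jgc.
Definition J_aut : tree_automaton := {|
  deg := 2; state := J_st;
  tau := fun q => match q with Ja => tau01 | _ => 1%g end;
  sect := fun q x => match q, val x with
                     | Jb, 0 => Ja | Jb, _ => Jc
                     | Jc, 0 => Jb | Jc, _ => J1
                     | _, _ => J1 end;
  gen := J_gen;
  gen_state := fun s => match s with Jga => Ja | Jgb => Jb | Jgc => Jc end |}.

(* Gupta-Sidki: a=(1,1,1)tau, b=(a,a^{-1},b); a^{-1}=(1,1,1)tau^{-1} *)
Inductive GS_st := GS1 | GSa | GSai | GSb.
Inductive GS_gen := GSga | GSgb.
Definition GS_aut : tree_automaton := {|
  deg := 3; state := GS_st;
  tau := fun q => match q with GSa => tau_cyc | GSai => (tau_cyc^-1)%g | _ => 1%g end;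
  sect := fun q x => match q, val x with
                     | GSb, 0 => GSa | GSb, 1 => GSai | GSb, _ => GSb
                     | _, _ => GS1 end;
  gen := GS_gen;
  gen_state := fun s => match s with GSga => GSa | GSgb => GSb end |}.

(* Fabrykowski-Gupta: a=(1,1,1)tau, b=(a,1,b) *)
Inductive FG_st := FG1 | FGa | FGb.
Inductive FG_gen := FGga | FGgb.
Definition FG_aut : tree_automaton := {|
  deg := 3; state := FG_st;
  tau := fun q => match q with FGa => tau_cyc | _ => 1%g end;
  sect := fun q x => match q, val x with
                     | FGb, 0 => FGa | FGb, 1 => FG1 | FGb, _ => FGb
                     | _, _ => FG1 end;
  gen := FG_gen;
  gen_state := fun s => match s with FGga => FGa | FGgb => FGb end |}.

(* Hanoi towers: a=(a,1,1)t12, b=(1,b,1)t02, c=(1,1,c)t01 *)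
Inductive H_st := H1 | Ha | Hb | Hc.
Inductive H_gen := Hga | Hgb | Hgc.
Definition H_aut : tree_automaton := {|
  deg := 3; state := H_st;
  tau := fun q => match q with Ha => t12 | Hb => t02 | Hc => t01 | H1 => 1%g end;
  sect := fun q x => match q, val x with
                     | Ha, 0 => Ha | Hb, 1 => Hb | Hc, 2 => Hc
                     | _, _ => H1 end;
  gen := H_gen;
  gen_state := fun s => match s with Hga => Ha | Hgb => Hb | Hgc => Hc end |}.

Inductive which_group := grp_J | grp_GS | grp_FG | grp_H.
Definition automaton_of (g : which_group) : tree_automaton :=
  match g with grp_J => J_aut | grp_GS => GS_aut | grp_FG => FG_aut | grp_H => H_aut end.

(* Main.v *)
(** Each of the four groups is generated by the images of the letters of a free product
    [P] of finite cyclic groups ([Z/2 * Z/2 * Z/2] or [Z/3 * Z/3]), and the wreath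
    recursion is already defined on [P]. It contracts there: two steps of it turn every
    product of two letters into a word of length at most 1. Hence a word acting trivially
    on the tree becomes trivial in the [N]-fold wreath power of [P] for all large [N].
    A finitely presented [G] mapping onto the group therefore maps to such a wreath power,
    because finitely many relators die at a common level [N]; and the image is that of all
    of [P], because finitely many letters are hit modulo words that die as well. Since the
    recursion is self-replicating, the section at a vertex of level [N] maps the stabiliser
    of that vertex in [G] onto [P]. Finally [P] has a finite-index subgroup mapping onto
    the free group of rank 2; the morphism from [P] to [F_2 wr Sym(k)] induced by that
    subgroup has the same format as the wreath recursion, so it serves as its level 0. *)

Require Import Defs.
From mathcomp Require Import all_boot all_fingroup.
From Stdlib Require Import Classical ProofIrrelevance IndefiniteDescription.
Set Implicit Arguments. Unset Strict Implicit. Unset Printing Implicit Defensive.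

(** * Groups and homomorphisms *)

Section GroupBasics.
Variable G : Grp.
Implicit Types x y : G.

Lemma gop_inj x y z : gop x y = gop x z -> y = z.
Proof. by move=> e; rewrite -(gop1l y) -(ginvl x) -gopA e gopA ginvl gop1l. Qed.

Lemma ginv_uniq x y : gop x y = gunit -> y = ginv x.
Proof. by move=> e; apply: (@gop_inj x); rewrite e ginvr. Qed.

Lemma ginvK x : ginv (ginv x) = x.
Proof. by rewrite -(@ginv_uniq (ginv x) x) // ginvl. Qed.

Lemma ginvM x y : ginv (gop x y) = gop (ginv y) (ginv x).
Proof.
by rewrite -(@ginv_uniq (gop x y) (gop (ginv y) (ginv x))) //
     gopA -(gopA x) ginvr gop1r ginvr.
Qed.

Lemma ginv1 : ginv gunit = gunit :> G.
Proof. by rewrite -(@ginv_uniq gunit gunit) // gop1l. Qed.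

End GroupBasics.

Lemma hom_unit (G H : Grp) (f : G -> H) : is_hom f -> f gunit = gunit.
Proof. by move=> hf; apply: (@gop_inj _ (f gunit)); rewrite -hf !gop1r. Qed.

Lemma hom_inv (G H : Grp) (f : G -> H) : is_hom f -> forall x, f (ginv x) = ginv (f x).
Proof. by move=> hf x; apply: ginv_uniq; rewrite -hf ginvr hom_unit. Qed.

Lemma hom_normal_closure (F H : Grp) (m : nat) (R : 'I_m -> F) (f : F -> H) :
  is_hom f -> (forall j, f (R j) = gunit) ->
  forall x, normal_closure R x -> f x = gunit.
Proof.
move=> hf fR x; elim=> {x} [i|||x _ ex|x g _ ex] //.
- exact: hom_unit.
- by move=> x y _ ex _ ey; rewrite hf ex ey gop1l.
- by rewrite hom_inv // ex ginv1.
- by rewrite !hf ex gop1l hom_inv // ginvl.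
Qed.

Section Subgroup.
Variables (F : Grp) (P : F -> Prop).
Hypothesis sP : is_subgroup P.

Lemma subgroup_eq (x y : {x | P x}) : sval x = sval y -> x = y.
Proof.
case: x y => [x px] [y py] /= e; case: y / e py => py.
by rewrite (proof_irrelevance _ px py).
Qed.


Let subM (x y : {x | P x}) : P (gop (sval x) (sval y)).
Proof. by case: sP => _ PM _; apply: PM; apply: svalP. Qed.

Let subV (x : {x | P x}) : P (ginv (sval x)).
Proof. by case: sP => _ _; apply; apply: svalP. Qed.

Let sub1 : P gunit. Proof. by case: sP. Qed.

Definition subgroup_grp : Grp.
Proof.
refine {| carrier := {x | P x};
  gop x y := exist P _ (subM x y); ginv x := exist P _ (subV x);
  gunit := exist P _ sub1 |} => *; apply: subgroup_eq;
  [exact: gopA | exact: gop1l | exact: gop1r | exact: ginvl | exact: ginvr].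
Defined.

Definition subgroup_val (x : subgroup_grp) : F := sval x.

(* The identity of F and the composite F -> P -> F agree on the basis. *)
Lemma free_ind (I : Type) (b : I -> F) :
  is_free_on b -> (forall i, P (b i)) -> forall x, P x.
Proof.
move=> fb Pb x.
have [f [hf fE _]] := fb subgroup_grp (fun i => exist P _ (Pb i)).
have [g [_ _ g_uniq]] := fb F b.
have fP y : P (subgroup_val (f y)) by apply: svalP.
suff <-: subgroup_val (f x) = x by [].
rewrite [RHS](g_uniq id) //; apply: (g_uniq (fun y => subgroup_val (f y))) => //.
- by move=> y z; rewrite hf.
- by move=> i; rewrite fE.
Qed.

End Subgroup.

(** * Words and the free group *)

Section Words.
Variables (T : Type) (G : Grp).
Implicit Types (w : seq T) (alpha : T -> G).

Definition evalG alpha w : G := foldr (fun t x => gop (alpha t) x) gunit w.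

Lemma evalG_cat alpha w1 w2 :
  evalG alpha (w1 ++ w2) = gop (evalG alpha w1) (evalG alpha w2).
Proof. by elim: w1 => [|t w1 ih] /=; rewrite ?gop1l // ih gopA. Qed.

Lemma evalG1 alpha t : evalG alpha [:: t] = alpha t.
Proof. exact: gop1r. Qed.

Lemma eq_evalG alpha beta : alpha =1 beta -> evalG alpha =1 evalG beta.
Proof. by move=> e; elim=> //= t w ->; rewrite e. Qed.

Lemma evalG_inv alpha (inv : T -> T) w :
  (forall t, alpha (inv t) = ginv (alpha t)) ->
  evalG alpha (rev (map inv w)) = ginv (evalG alpha w).
Proof.
move=> alphaV; elim: w => [|t w ih] /=; first by rewrite ginv1.
by rewrite rev_cons -cats1 evalG_cat ih evalG1 alphaV ginvM.
Qed.

(* [mul t u = Some s] is a rewriting rule [t u -> s]; [None] means irreducible. *)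
Variable mul : T -> T -> option (seq T).

(** The result [s ++ w'] is not scanned again. In the rules used here [s] is empty or one letter of
    the same factor, so an irreducible [w] still yields an irreducible word. *)
Definition push t w :=
  if w is u :: w' then if mul t u is Some s then s ++ w' else t :: w else [:: t].

Definition red w := foldr push [::] w.

Hypothesis (alpha : T -> G).
Hypothesis mulE : forall t u s, mul t u = Some s -> evalG alpha [:: t; u] = evalG alpha s.

Lemma evalG_push t w : evalG alpha (push t w) = gop (alpha t) (evalG alpha w).
Proof.
case: w => [|u w] //=; case e: (mul t u) => [s|] //=.
by rewrite evalG_cat -(mulE e) /= gop1r gopA.
Qed.

Lemma evalG_red w : evalG alpha (red w) = evalG alpha w.
Proof. by elim: w => //= t w ih; rewrite evalG_push ih. Qed.

End Words.

Lemma hom_evalG (T : Type) (G H : Grp) (f : G -> H) (alpha : T -> G) w :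
  is_hom f -> f (evalG alpha w) = evalG (fun t => f (alpha t)) w.
Proof. by move=> hf; elim: w => [|t w ih] /=; rewrite ?hom_unit // hf ih. Qed.

Section FreeGroup.
Variable I : eqType.
Notation L := (I * bool)%type.

Definition flip (t : L) : L := (t.1, ~~ t.2).

Lemma flipK : involutive flip.
Proof. by case=> i e; rewrite /flip /= negbK. Qed.

Definition free_mul (t u : L) : option (seq L) := if u == flip t then Some [::] else None.

Lemma free_mul_flip t : free_mul t (flip t) = Some [::].
Proof. by rewrite /free_mul eqxx. Qed.

Lemma free_mulN t u : u != flip t -> free_mul t u = None.
Proof. by rewrite /free_mul => /negPf->. Qed.

Notation fpush := (push free_mul).

Definition reduced (w : seq L) := sorted (fun t u => u != flip t) w.

Lemma push_reduced t w : reduced w -> reduced (fpush t w).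
Proof.
case: w => [|u w] //= rw; rewrite /free_mul; case: eqP => [_|/eqP ne] /=.
  exact: path_sorted rw.
by rewrite ne.
Qed.

(** Letters act on reduced words by permutations, [flip t] inverting [t]. This is van der Waerden's
    trick: associativity in the free group comes from this action, not from confluence. *)
Lemma pushK t w : reduced w -> fpush (flip t) (fpush t w) = w.
Proof.
case: w => [|u w] /= rw; rewrite /free_mul /=; first by rewrite flipK eqxx.
case: eqP rw => [-> {u}|_] /=; last by rewrite flipK eqxx.
by case: w => [|v w] //= /andP[/negPf->].
Qed.

Lemma foldr_push_reduced w s : reduced s -> reduced (foldr fpush s w).
Proof. by move=> rs; elim: w => //= t w; apply: push_reduced. Qed.

Lemma foldr_push t w s :
  reduced s -> foldr fpush s (fpush t w) = fpush t (foldr fpush s w).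
Proof.
move=> rs; case: w => [|u w] //=; have [->|ne] := eqVneq u (flip t).
  rewrite free_mul_flip /=.
  by have := pushK (flip t) (foldr_push_reduced w rs); rewrite flipK.
by rewrite free_mulN.
Qed.

Lemma foldr_pushA u v s : reduced s ->
  foldr fpush s (foldr fpush v u) = foldr fpush (foldr fpush s v) u.
Proof. by move=> rs; elim: u => //= t u ih; rewrite foldr_push // ih. Qed.

Lemma red_reduced w : reduced w -> red free_mul w = w.
Proof.
elim: w => //= t [|u w] ih rw //; have /andP[ne rw'] := rw.
by rewrite -/(red _) ih //= /free_mul (negPf ne).
Qed.

Definition fword := {w : seq L | reduced w}.

Definition fop (x y : fword) : fword :=
  exist reduced _ (foldr_push_reduced (sval x) (svalP y)).

Definition funit : fword := exist reduced [::] isT.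

(** The reversed and flipped word is already reduced; applying [red] makes the proof of reducedness
    immediate. *)
Definition finv (x : fword) : fword :=
  exist reduced (red free_mul (rev (map flip (sval x)))) (@foldr_push_reduced _ [::] isT).

Lemma fop1r x : fop x funit = x.
Proof. by apply: val_inj; exact: red_reduced (svalP x). Qed.

Lemma fopA x y z : fop x (fop y z) = fop (fop x y) z.
Proof. by apply: val_inj; rewrite /= foldr_pushA //; exact: svalP z. Qed.

Lemma fop1l x : fop funit x = x.
Proof. exact: val_inj. Qed.

Lemma finvl x : fop (finv x) x = funit.
Proof.
apply: val_inj; rewrite /= /red foldr_pushA /=; last exact: svalP x.
case: x => w /= _; elim: w => //= t w ih.
by rewrite rev_cons -cats1 foldr_cat /= /free_mul flipK eqxx.
Qed.

Lemma finvr x : fop x (finv x) = funit.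
Proof.
rewrite -[LHS]fop1l -{1}(finvl (finv x)) -fopA (fopA (finv x)) finvl fop1l.
exact: finvl.
Qed.

Definition free_grp : Grp := Build_Grp fopA fop1l fop1r finvl finvr.

Definition fgen (t : L) : free_grp := exist reduced [:: t] isT.

Lemma fgen_inv t : fgen (flip t) = ginv (fgen t).
Proof.
by apply: ginv_uniq; apply: val_inj; rewrite /= free_mul_flip.
Qed.

Lemma fgenE (x : free_grp) : x = evalG fgen (sval x).
Proof.
apply: val_inj; rewrite -[LHS](red_reduced (svalP x)) /=.
by elim: (sval x) => //= t w ->.
Qed.

Lemma free_mulE (H : Grp) (h : L -> H) t u s :
  (forall v, h (flip v) = ginv (h v)) ->
  free_mul t u = Some s -> evalG h [:: t; u] = evalG h s.
Proof.
rewrite /free_mul => h_flip; case: eqP => // -> [<-] /=.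
by rewrite h_flip gop1r ginvr.
Qed.

Lemma free_grp_free : is_free_on (fun i => fgen (i, true)).
Proof.
move=> H g; pose h (t : L) := if t.2 then g t.1 else ginv (g t.1).
have h_flip t : h (flip t) = ginv (h t).
  by case: t => i []; rewrite /h //= ginvK.
have hE t u s := @free_mulE H h t u s h_flip.
exists (fun x => evalG h (sval x)); split=> [x y|i|psi hpsi psiE x].
- rewrite /=; elim: (sval x) => [|t w ih] /=; first by rewrite gop1l.
  by rewrite (evalG_push hE) ih gopA.
- by rewrite /= gop1r.
- rewrite [in LHS](fgenE x) hom_evalG //; apply: eq_evalG => -[i []] /=.
    exact: psiE.
  by rewrite (fgen_inv (i, true)) hom_inv // psiE.
Qed.

End FreeGroup.

(** * Wreath products and virtual epimorphisms *)

Section Wreath.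
Variables (d : nat) (H : Grp).
Implicit Types x y z : {perm 'I_d} * {ffun 'I_d -> H}.

(** Products act as functions, [y] first, while permutations multiply from left to right. The second
    component is the section rule $(xy)_i = x_{y(i)} y_i$. *)
Definition wop x y := ((y.1 * x.1)%g, [ffun i => gop (x.2 (y.1 i)) (y.2 i)]).

Definition winv x := ((x.1^-1)%g, [ffun i => ginv (x.2 ((x.1^-1)%g i))]).

Definition wunit : {perm 'I_d} * {ffun 'I_d -> H} := (1%g, [ffun => gunit]).

Lemma wr_eq x y : x.1 =1 y.1 -> x.2 =1 y.2 -> x = y.
Proof. by case: x y => [s f] [t g] /= /permP-> /ffunP->. Qed.

Definition wr_grp : Grp.
Proof.
refine {| carrier := {perm 'I_d} * {ffun 'I_d -> H};
  gop := wop; ginv := winv; gunit := wunit |}.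
- move=> x y z; apply: wr_eq => i; rewrite /= ?mulgA // !ffunE /=.
  by rewrite permM gopA.
- by move=> x; apply: wr_eq => i; rewrite /= ?mulg1 // !ffunE gop1l.
- by move=> x; apply: wr_eq => i; rewrite /= ?mul1g // !ffunE perm1 gop1r.
- by move=> x; apply: wr_eq => i; rewrite /= ?mulgV // !ffunE permK ginvl.
- by move=> x; apply: wr_eq => i; rewrite /= ?mulVg // !ffunE ginvr.
Defined.

End Wreath.

(** The image need only contain [P]: in a wreath power, [P] will be the subgroup spanned by the
    letters. *)
Definition virtually_maps_onto (G H : Grp) (P : H -> Prop) : Prop :=
  exists (S : G -> Prop) (f : G -> H),
    [/\ is_subgroup S, finite_index S,
        (forall x y, S x -> S y -> f (gop x y) = gop (f x) (f y)) &
        (forall z, P z -> exists x, S x /\ f x = z)].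

Lemma hom_on_unit (G H : Grp) (S : G -> Prop) (f : G -> H) :
  is_subgroup S -> (forall x y, S x -> S y -> f (gop x y) = gop (f x) (f y)) ->
  f gunit = gunit.
Proof.
by case=> S1 _ _ hf; apply: (@gop_inj _ (f gunit)); rewrite -hf // !gop1r.
Qed.

Lemma hom_on_inv (G H : Grp) (S : G -> Prop) (f : G -> H) :
  is_subgroup S -> (forall x y, S x -> S y -> f (gop x y) = gop (f x) (f y)) ->
  forall x, S x -> f (ginv x) = ginv (f x).
Proof.
move=> sS hf x Sx; have [_ _ SV] := sS.
by apply: ginv_uniq; rewrite -hf ?ginvr //; [exact: hom_on_unit sS hf | exact: SV].
Qed.

Lemma finite_indexI (G : Grp) (S : G -> Prop) (I : finType) (r : I -> G) :
  (forall x, exists i, S (gop (ginv (r i)) x)) -> finite_index S.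
Proof.
move=> rP; exists #|I|, (fun i => r (enum_val i)) => x.
by have [i Si] := rP x; exists (enum_rank i); rewrite enum_rankK.
Qed.

(** The stabiliser of [v] in [S] has finite index because the orbit of [v] is finite, and by the
    section rule the section at [v] is multiplicative on it. *)
Lemma virtually_maps_onto_section (G H : Grp) (d : nat) (v : 'I_d)
    (P : wr_grp d H -> Prop) :
  virtually_maps_onto G P ->
  virtually_maps_onto G (fun h => exists z : wr_grp d H, [/\ P z, z.1 v = v & z.2 v = h]).
Proof.
case=> S [f [sS [m [r rP]] hf fP]]; have [S1 SM SV] := sS.
have fV := hom_on_inv sS hf.
(* [t y] carries [v] to [y] when [y] lies in the orbit of [v] under [S]; elsewhere [gunit] is a
   default. *)
have [t tP] : exists t : 'I_d -> G, forall y,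
    (exists s, S s /\ (f s).1 v = y) -> S (t y) /\ (f (t y)).1 v = y.
  apply: (fin_all_exists (P := fun y g => (exists s, S s /\ (f s).1 v = y) ->
    S g /\ (f g).1 v = y)) => y.
  have [[s sP]|no] := classic (exists s, S s /\ (f s).1 v = y); first by exists s.
  by exists gunit => /no.
exists (fun x => S x /\ (f x).1 v = v), (fun x => (f x).2 v); split.
- split=> [|x y [Sx fx] [Sy fy]|x [Sx fx]].
  + by split=> //; rewrite (hom_on_unit sS hf) /= perm1.
  + by split; [exact: SM | rewrite hf //= permM fy].
  + by split; [exact: SV | rewrite fV //= -{1}fx; exact: permK].
(* Representatives are products of one for [S] in [G] and one for the stabiliser in [S]. *)
- apply: (@finite_indexI _ _ ('I_m * 'I_d)%type (fun i => gop (r i.1) (t i.2))) => x.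
  have [i Si] := rP x; set s := gop _ x in Si; set y := (f s).1 v.
  have [St ty] := tP y (ex_intro _ s (conj Si erefl)).
  exists (i, y); rewrite ginvM -gopA -/s; split; first by apply: SM => //; apply: SV.
  by rewrite hf //= ?fV //=; [rewrite permM -/y -{2}ty; exact: permK | exact: SV].
- move=> x y [Sx _] [Sy fy]; rewrite hf //= ffunE fy //.
- by move=> _ [z [/fP[x [Sx <-]] zv <-]]; exists x.
Qed.

Lemma virtually_maps_onto_sub (G H : Grp) (P Q : H -> Prop) :
  (forall h, Q h -> P h) -> virtually_maps_onto G P -> virtually_maps_onto G Q.
Proof.
move=> QP [S [f [sS iS hf fP]]]; exists S, f; split=> // z /QP; exact: fP.
Qed.

Lemma large_of_free (G : Grp) :
  virtually_maps_onto G (fun _ : free_grp bool => True) -> large G.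
Proof.
case=> S [f [sS iS hf fP]]; exists S; split=> //.
exists (free_grp bool), bool, (fun i => fgen (i, true)), f; split=> //.
- exact: free_grp_free.
- by exists true, false.
- by move=> z; apply: fP.
Qed.

(** * Wreath recursions on words *)

Record transducer (T U : Type) (d : nat) := Transducer {
  move : T -> 'I_d -> 'I_d;
  out : T -> 'I_d -> seq U;
  move_inj : forall t, injective (move t) }.

Section Transducer.
Variables (T U : Type) (d : nat) (A : transducer T U d).

Fixpoint wmove (w : seq T) (x : 'I_d) : 'I_d :=
  if w is t :: w' then move A t (wmove w' x) else x.

Fixpoint wout (w : seq T) (x : 'I_d) : seq U :=
  if w is t :: w' then out A t (wmove w' x) ++ wout w' x else [::].

Lemma wmove_cat w1 w2 x : wmove (w1 ++ w2) x = wmove w1 (wmove w2 x).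
Proof. by elim: w1 => //= t w1 ->. Qed.

Lemma wout_cat w1 w2 x : wout (w1 ++ w2) x = wout w1 (wmove w2 x) ++ wout w2 x.
Proof. by elim: w1 => //= t w1 ->; rewrite wmove_cat catA. Qed.

Variables (H : Grp) (alpha : U -> H).

Definition lift_wr (t : T) : wr_grp d H :=
  (perm (@move_inj _ _ _ A t), [ffun x => evalG alpha (out A t x)]).

Lemma lift_wr1 w x : (evalG lift_wr w).1 x = wmove w x.
Proof. by elim: w => [|t w ih] /=; rewrite ?perm1 // permM ih permE. Qed.

Lemma lift_wr2 w x : (evalG lift_wr w).2 x = evalG alpha (wout w x).
Proof.
elim: w => [|t w ih] /=; rewrite ffunE //= ffunE lift_wr1 ih.
by rewrite evalG_cat.
Qed.

Lemma lift_wr_eq w w' :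
  evalG lift_wr w = evalG lift_wr w' <->
  (forall x, wmove w x = wmove w' x /\ evalG alpha (wout w x) = evalG alpha (wout w' x)).
Proof.
split=> [e x|e]; first by rewrite -!lift_wr1 -!lift_wr2 e.
by apply: wr_eq => x; have [e1 e2] := e x; rewrite ?lift_wr1 ?lift_wr2.
Qed.

End Transducer.

Section Action.
Variables (T : Type) (d : nat) (A : transducer T T d).

Fixpoint wact (w : seq T) (v : seq 'I_d) : seq 'I_d :=
  if v is x :: v' then wmove A w x :: wact (wout A w x) v' else [::].

Lemma wact_cat w1 w2 v : wact (w1 ++ w2) v = wact w1 (wact w2 v).
Proof. by elim: v w1 w2 => //= x v ih w1 w2; rewrite wmove_cat wout_cat ih. Qed.

Lemma wact_nil v : wact [::] v = v.
Proof. by elim: v => //= x v ->. Qed.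

Lemma wact_trivialS w : wact w =1 id ->
  forall x, wmove A w x = x /\ wact (wout A w x) =1 id.
Proof.
move=> w1 x; split; first by have [] := w1 [:: x].
by move=> v; have [] := w1 (x :: v).
Qed.

End Action.

(* The free product is spanned by [letter], with multiplication rules [lmul]; [tree] is the
   wreath recursion on it and [base] a morphism from it to a wreath product of the free
   group of rank 2 with [Sym(base_deg.+1)]. In [letter_gen], as in [act_letter], a true
   boolean marks an inverse; [letter_bound] says that there are finitely many letters. *)
Record cover (A : tree_automaton) := Cover {
  letter : Type;
  linv : letter -> letter;
  lmul : letter -> letter -> option (seq letter);
  tree : transducer letter letter (deg A);
  vertex : 'I_(deg A);
  base_deg : nat;
  base : transducer letter (bool * bool) base_deg.+1;
  state_word : state A -> seq letter;
  gen_letter : gen A -> letter;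
  letter_bound : forall N : letter -> nat, exists M, forall t, N t <= M;
  lmulV : forall t, lmul t (linv t) = Some [::];
  lmul_tree : forall t u s, lmul t u = Some s -> forall x,
    wmove tree [:: t; u] x = wmove tree s x /\
    red lmul (wout tree [:: t; u] x) = red lmul (wout tree s x);
  lmul_base : forall t u s, lmul t u = Some s -> forall x,
    wmove base [:: t; u] x = wmove base s x /\
    red (@free_mul bool) (wout base [:: t; u] x) = red (@free_mul bool) (wout base s x);
  size_out : forall t x, size (out tree t x) <= 1;
  contract : forall t u x y,
    size (red lmul (wout tree (wout tree [:: t; u] x) y)) <= 1;
  letter_acts : forall t, exists v, wact tree [:: t] v <> v;
  tree_replicates : forall t, exists w,
    wmove tree w vertex = vertex /\ red lmul (wout tree w vertex) = [:: t];
  base_replicates : forall g, exists w,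
    wmove base w ord0 = ord0 /\ red (@free_mul bool) (wout base w ord0) = [:: g];
  state_wordE : forall q x, tau q x = wmove tree (state_word q) x /\
    state_word (sect q x) = wout tree (state_word q) x;
  state_word_gen : forall s, state_word (gen_state s) = [:: gen_letter s];
  letter_gen : forall t, exists l : gen A * bool,
    t = if l.2 then linv (gen_letter l.1) else gen_letter l.1 }.

(** * Levels of a cover, contraction and self-replication *)

Section Cover.
Variables (A : tree_automaton) (C : cover A).
Notation T := (letter C).
Notation B := (tree C).
Notation F2 := (free_grp bool).
Implicit Types (t u : T) (w : seq T).

Fixpoint W (N : nat) : Grp :=
  if N is N'.+1 then wr_grp (deg A) (W N') else wr_grp (base_deg C).+1 F2.

(** The free product is never built as a group: words stand for its elements and are compared
    through these maps. *)
Fixpoint Phi (N : nat) : T -> W N :=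
  if N is N'.+1 then lift_wr B (Phi N') else lift_wr (base C) (@fgen bool).

Lemma evalG_red_free (w : seq (bool * bool)) :
  evalG (@fgen bool) (red (@free_mul bool) w) = evalG (@fgen bool) w.
Proof. by apply: evalG_red => t u s; apply: free_mulE; apply: fgen_inv. Qed.

(** [lmul_base] gives level 0. [lmul_tree] carries the rules up: it compares sections up to [red],
    which by induction preserves values one level below. *)
Lemma Phi_mul N t u s : lmul t u = Some s -> evalG (@Phi N) [:: t; u] = evalG (@Phi N) s.
Proof.
elim: N t u s => [|N ih] t u s tu; apply/lift_wr_eq => x.
  have [e1 e2] := lmul_base tu x; split=> //.
  by rewrite -[LHS]evalG_red_free e2 evalG_red_free.
have [e1 e2] := lmul_tree tu x; split=> //.
by rewrite -[LHS](evalG_red ih) e2 evalG_red.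
Qed.

Lemma Phi_red N w : evalG (@Phi N) (red (@lmul _ C) w) = evalG (@Phi N) w.
Proof. by apply: evalG_red => t u s; apply: Phi_mul. Qed.

Lemma Phi_linv N t : Phi N (linv t) = ginv (Phi N t).
Proof.
by apply: ginv_uniq; have := Phi_mul N (lmulV t); rewrite /= gop1r.
Qed.

Definition word_inv w := rev (map (@linv _ C) w).

Lemma Phi_inv N w : evalG (@Phi N) (word_inv w) = ginv (evalG (@Phi N) w).
Proof. by apply: evalG_inv; apply: Phi_linv. Qed.

(** Level [N.+1] sees the permutation of the first letter and the level [N] values of the sections,
    so the equality descends the tree. *)
Lemma wact_eq w w' :
  (forall N, evalG (@Phi N) w = evalG (@Phi N) w') -> wact B w =1 wact B w'.
Proof.
move=> e v; elim: v w w' e => //= x v ih w w' e.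
have eS N : wmove B w x = wmove B w' x /\
    evalG (@Phi N) (wout B w x) = evalG (@Phi N) (wout B w' x).
  by have /lift_wr_eq := e N.+1; apply.
congr (_ :: _); first by case: (eS 0).
by apply: ih => N; case: (eS N).
Qed.

Lemma wact_invl w : cancel (wact B w) (wact B (word_inv w)).
Proof.
move=> v; rewrite -wact_cat -[RHS](wact_nil B); apply: wact_eq => N.
by rewrite evalG_cat Phi_inv ginvl.
Qed.

Lemma wact_invr w : cancel (wact B (word_inv w)) (wact B w).
Proof.
move=> v; rewrite -wact_cat -[RHS](wact_nil B); apply: wact_eq => N.
by rewrite evalG_cat Phi_inv ginvr.
Qed.

(** Asking for all large levels lets finitely many words be trivial at a common one. *)
Definition eventually_trivial w := exists N, forall M, N <= M -> evalG (@Phi M) w = gunit.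

Lemma eventually_trivialS w :
  (forall x, wmove B w x = x) -> (forall x, eventually_trivial (wout B w x)) ->
  eventually_trivial w.
Proof.
move=> w1 /fin_all_exists[N NP]; exists (\max_x N x).+1 => -[//|M] leM.
apply: (proj2 (lift_wr_eq B (@Phi M) w [::])) => x; split; first exact: w1.
by apply: NP; apply: leq_trans (leq_bigmax x) _; rewrite -ltnS.
Qed.

Lemma size_wout w x : size (wout B w x) <= size w.
Proof.
elim: w => //= t w ih; rewrite size_cat -add1n.
by apply: leq_add ih; apply: size_out.
Qed.

(** Induction on length; a single letter never acts trivially. A longer word fixes the first two
    levels, and its sections there act trivially and become shorter, since the first two letters
    contract to at most one. *)
Lemma contraction w :
  wact B w =1 id -> eventually_trivial w.
Proof.
have [n] := ubnP (size w); elim: n w => // n ih [|t [|u w]] /= lt_n w1.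
- by exists 0.
- by have [v []] := letter_acts t; rewrite w1.
set z := [:: t, u & w] in w1 *.
apply: eventually_trivialS => x; first by case: (wact_trivialS w1 x).
have [_ wx1] := wact_trivialS w1 x.
apply: eventually_trivialS => y; first by case: (wact_trivialS wx1 y).
have [_ wxy1] := wact_trivialS wx1 y.
(* [p] comes from the prefix [[:: t; u]], read at the vertex to which [w] moves [x], [y]; [q] comes
   from [w]. *)
set p := wout B (wout B [:: t; u] (wmove B w x)) (wmove B (wout B w x) y).
set q := wout B (wout B w x) y.
have zE : wout B (wout B z x) y = p ++ q.
  by rewrite (wout_cat B [:: t; u]) (wout_cat B (wout B _ _)).
rewrite zE in wxy1 *.
(* Reducing [p] preserves the values at all levels, hence also the action by [wact_eq]. *)
have pq M : evalG (@Phi M) (red (@lmul _ C) p ++ q) = evalG (@Phi M) (p ++ q).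
  by rewrite !evalG_cat Phi_red.
have [||N NP] := ih (red (@lmul _ C) p ++ q).
- have le_q : size q <= size w := leq_trans (size_wout _ _) (size_wout _ _).
  by rewrite size_cat; apply: leq_ltn_trans (leq_add (contract _ _ _ _) le_q) _.
- by move=> v; rewrite (wact_eq pq).
- by exists N => M /NP; rewrite pq.
Qed.


Lemma replicates w : exists w',
  wmove B w' (vertex C) = vertex C /\
  forall N, evalG (@Phi N) (wout B w' (vertex C)) = evalG (@Phi N) w.
Proof.
elim: w => [|t w [w' [w1 w2]]]; first by exists [::].
have [s [s1 s2]] := tree_replicates t.
exists (s ++ w'); split=> [|N]; first by rewrite wmove_cat w1.
by rewrite wout_cat evalG_cat w1 w2 -[in LHS]Phi_red s2 evalG1.
Qed.

Lemma base_replicates_word (g : seq (bool * bool)) : exists w,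
  wmove (base C) w ord0 = ord0 /\
  evalG (@fgen bool) (wout (base C) w ord0) = evalG (@fgen bool) g.
Proof.
elim: g => [|t g [w' [w1 w2]]]; first by exists [::].
have [s [s1 s2]] := base_replicates C t.
exists (s ++ w'); split; first by rewrite wmove_cat w1.
by rewrite wout_cat evalG_cat w1 w2 -[in LHS]evalG_red_free s2 evalG1.
Qed.

(** The section at [vertex] lowers the level by one and keeps the image full by self-replication; at
    level 0 the section at [ord0] reaches the whole free group. *)
Lemma large_of_Phi (G : Grp) N :
  virtually_maps_onto G (fun z : W N => exists w, evalG (@Phi N) w = z) -> large G.
Proof.
elim: N => [|N ih] /=.
  move/(virtually_maps_onto_section ord0) => h; apply: large_of_free.
  apply: virtually_maps_onto_sub h => g _.
  have [w [w1 w2]] := base_replicates_word (sval g).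
  exists (evalG (@Phi 0) w); split; first by exists w.
  - by rewrite lift_wr1.
  - by rewrite lift_wr2 w2 -fgenE.
move/(virtually_maps_onto_section (vertex C)) => h; apply: ih.
apply: virtually_maps_onto_sub h => z [w <-].
have [w' [w1 w2]] := replicates w.
exists (evalG (@Phi N.+1) w'); split; first by exists w'.
- by rewrite lift_wr1.
- by rewrite lift_wr2.
Qed.

Lemma act_word q v : Defs.act q v = wact B (state_word C q) v.
Proof.
elim: v q => //= x v ih q; have [-> e] := state_wordE C q x.
by rewrite ih e.
Qed.

Lemma actKV (q : state A) v : Defs.act q (act_inv q v) = v.
Proof. by elim: v q => //= y v ih q; rewrite permKV ih. Qed.

Definition letter_of (l : gen A * bool) : T :=
  if l.2 then linv (gen_letter C l.1) else gen_letter C l.1.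

(** For an inverse letter, [act_inv] is a right inverse and [linv] a left inverse of the same
    map. *)
Lemma act_letterE l v : act_letter l v = wact B [:: letter_of l] v.
Proof.
case: l => g []; rewrite /act_letter /letter_of /=; last first.
  by rewrite act_word state_word_gen.
have e : wact B [:: gen_letter C g] (act_inv (gen_state g) v) = v.
  by rewrite -state_word_gen -act_word actKV.
rewrite -[v in RHS]e; exact/esym/(wact_invl [:: gen_letter C g]).
Qed.

Lemma eval_wordE ls v : eval_word ls v = wact B (map letter_of ls) v.
Proof.
elim: ls => [|l ls ih] /=; first by rewrite wact_nil.
by rewrite act_letterE ih -wact_cat.
Qed.

Lemma large_of_epi_onto (G : Grp) : finitely_presented G -> epi_onto G A -> large G.
Proof.
case=> n [F [b [p [m [R [bF hp p_onto kerp]]]]]] [f [hf f_in f_onto]].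
have [u uP] : exists u : 'I_n -> seq T, forall i, f (p (b i)) =1 wact B (u i).
  apply: (fin_all_exists (P := fun i w => f (p (b i)) =1 wact B w)) => i.
  have [ls lsE] := f_in (p (b i)); exists (map letter_of ls) => v.
  by rewrite lsE eval_wordE.
(* [f gunit] is idempotent, and surjective because it is the action of a word; so it is the
   identity. *)
have f1 v : f gunit v = v.
  have [ls lsE] := f_in gunit.
  have fE v' : f gunit v' = wact B (map letter_of ls) v' by rewrite lsE eval_wordE.
  have := hf gunit gunit (wact B (word_inv (map letter_of ls)) v).
  by rewrite gop1l fE wact_invr.
(* One word records both the action of [p x] and the value at [x] of every later [Th]. The level
   stays open, because its choice depends on these words. *)
have word_of x : exists w, f (p x) =1 wact B w /\
    forall N (Th : F -> W N), is_hom Th -> (forall i, Th (b i) = evalG (@Phi N) (u i)) ->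
    Th x = evalG (@Phi N) w.
  move: x; apply: (free_ind _ bF) => [|i]; last by exists (u i); split=> // N Th _; apply.
  split=> [|x y [w [wf wTh]] [w' [wf' wTh']]|x [w [wf wTh]]].
  - exists [::]; split=> [v|N Th hTh _]; last exact: hom_unit.
    by rewrite (hom_unit hp) f1 wact_nil.
  - exists (w ++ w'); split=> [v|N Th hTh Thb].
      by rewrite hp hf wf wf' wact_cat.
    by rewrite hTh evalG_cat (wTh _ _ hTh Thb) (wTh' _ _ hTh Thb).
  - exists (word_inv w); split=> [v|N Th hTh Thb].
      rewrite (hom_inv hp) -{1}(wact_invr w v) -wf.
      by have := hf (ginv (p x)) (p x); rewrite ginvl => <-; rewrite f1.
    by rewrite (hom_inv hTh) Phi_inv (wTh _ _ hTh Thb).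
have [wR wRP] := functional_choice _ (fun j => word_of (R j)).
have lift t : exists x, f (p x) =1 wact B [:: t].
  have [l tE] := letter_gen t.
  have [|g gE] := f_onto (eval_word [:: l]); first by exists [:: l].
  have [x xE] := p_onto g; exists x => v; rewrite xE gE /= act_letterE.
  by rewrite /letter_of -tE.
have trivR j : eventually_trivial (wR j).
  have [wf _] := wRP j; apply: contraction => v; rewrite -wf.
  by rewrite (proj2 (kerp _) (nc_rel R j)) f1.
have [l lP] := functional_choice _ lift.
(* The word of the lift [l t] acts like the letter [t], so the two agree at all large levels. *)
have trivT t : exists N, forall M, N <= M -> forall (Th : F -> W M), is_hom Th ->
    (forall i, Th (b i) = evalG (@Phi M) (u i)) -> Th (l t) = Phi M t.
  have [w [wf wTh]] := word_of (l t).
  have [|N NP] := @contraction (w ++ [:: linv t]).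
    by move=> v; rewrite wact_cat -wf lP; apply: (wact_invr [:: t]).
  exists N => M /NP; rewrite evalG_cat => e Th hTh Thb.
  have := ginv_uniq e; rewrite evalG1 Phi_linv => e'.
  by rewrite (wTh _ _ hTh Thb) -[LHS]ginvK -e' ginvK.
have [NR NRP] := fin_all_exists trivR.
have [NT NTP] := functional_choice _ trivT.
have [M MP] := letter_bound NT.
(* At this level the relators die, so [Th] factors through [G], and each [l t] goes to [Phi N t], so
   the image contains the values of all words. *)
pose N := maxn (\max_j NR j) M.
have [Th [hTh Thb _]] := bF (W N) (fun i => evalG (@Phi N) (u i)).
have ThR j : Th (R j) = gunit.
  have [_ /(_ _ Th hTh Thb)->] := wRP j; apply: NRP.
  by rewrite leq_max leq_bigmax.
have Th_ker x : p x = gunit -> Th x = gunit.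
  by move/kerp; apply: hom_normal_closure.
have Th_eq x y : p x = p y -> Th x = Th y.
  move=> e; have := Th_ker (gop (ginv x) y); rewrite hp hTh !(hom_inv hp) !(hom_inv hTh).
  rewrite e ginvl => /(_ erefl) e1.
  by rewrite (ginv_uniq e1) ginvK.
have [q qP] := functional_choice _ p_onto.
(* The map on [G] is [Th] after a set-theoretic section [q] of [p]; it is multiplicative because
   [Th] kills the kernel of [p]. *)
apply: (@large_of_Phi G N); exists (fun _ => True), (fun g => Th (q g)); split=> //.
- by exists 1, (fun _ => gunit) => x; exists ord0.
- by move=> x y _ _; rewrite -hTh; apply: Th_eq; rewrite hp !qP.
- move=> _ [w <-]; exists (p (evalG l w)); split=> //.
  rewrite (Th_eq _ (evalG l w)) // hom_evalG //; apply: eq_evalG => t.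
  by apply: NTP => //; rewrite leq_max MP orbT.
Qed.

End Cover.

(** * The four groups *)

(** Explicit ordinals let the finite checks below go through by computation. *)
Definition ord2 (i : nat) : 'I_2 := if i is 0 then @Ordinal 2 0 isT else @Ordinal 2 1 isT.

Definition ord3 (i : nat) : 'I_3 :=
  match i with 0 => @Ordinal 3 0 isT | 1 => @Ordinal 3 1 isT | _ => @Ordinal 3 2 isT end.

Lemma ord2_ind (P : 'I_2 -> Prop) : P (ord2 0) -> P (ord2 1) -> forall x, P x.
Proof.
move=> P0 P1 [[|[|//]] lt_i].
- by rewrite (_ : Ordinal lt_i = ord2 0) //; apply: val_inj.
- by rewrite (_ : Ordinal lt_i = ord2 1) //; apply: val_inj.
Qed.

Lemma ord3_ind (P : 'I_3 -> Prop) :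
  P (ord3 0) -> P (ord3 1) -> P (ord3 2) -> forall x, P x.
Proof.
move=> P0 P1 P2 [[|[|[|//]]] lt_i].
- by rewrite (_ : Ordinal lt_i = ord3 0) //; apply: val_inj.
- by rewrite (_ : Ordinal lt_i = ord3 1) //; apply: val_inj.
- by rewrite (_ : Ordinal lt_i = ord3 2) //; apply: val_inj.
Qed.

Definition swap2 (x : 'I_2) := ord2 (if val x is 0 then 1 else 0).

Definition next3 (x : 'I_3) := ord3 (match val x with 0 => 1 | 1 => 2 | _ => 0 end).

Definition prev3 (x : 'I_3) := ord3 (match val x with 0 => 2 | 1 => 0 | _ => 1 end).

Lemma swap2K : involutive swap2.
Proof. by apply: ord2_ind. Qed.

Lemma next3K : cancel next3 prev3.
Proof. by apply: ord3_ind. Qed.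

Lemma prev3K : cancel prev3 next3.
Proof. by apply: ord3_ind. Qed.

Lemma tau01E x : tau01 x = swap2 x.
Proof.
rewrite /tau01 (_ : inord 1 = ord2 1); last by apply: val_inj; rewrite /= inordK.
by elim/ord2_ind: x; apply: val_inj; rewrite permE.
Qed.

Lemma tau_cycE x : tau_cyc x = next3 x.
Proof. by elim/ord3_ind: x; apply: val_inj; rewrite permE. Qed.

Lemma tau_cycVE x : (tau_cyc^-1)%g x = prev3 x.
Proof. by apply: (@perm_inj _ tau_cyc); rewrite permKV tau_cycE prev3K. Qed.

(** * The two free products and their virtual epimorphisms onto $F_2$ *)

Inductive letter2 := xa | xb | xc.

Definition mul2 (t u : letter2) : option (seq letter2) :=
  match t, u with xa, xa | xb, xb | xc, xc => Some [::] | _, _ => None end.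

(* Identifies the subgroup of words of even length with the free group on ab and ac. *)
Definition base2 : transducer letter2 (bool * bool) 2 :=
  @Transducer letter2 (bool * bool) 2 (fun _ => swap2)
    (fun t x => match t, val x with
      | xa, _ => [::]
      | xb, 0 => [:: (true, true)] | xb, _ => [:: (true, false)]
      | xc, 0 => [:: (false, true)] | xc, _ => [:: (false, false)] end)
    (fun _ => inv_inj swap2K).

Lemma base2_replicates g : exists w,
  wmove base2 w ord0 = ord0 /\ red (@free_mul bool) (wout base2 w ord0) = [:: g].
Proof.
by case: g => [[] []]; [exists [:: xa; xb] | exists [:: xb; xa] |
  exists [:: xa; xc] | exists [:: xc; xa]]; split=> //; apply: val_inj.
Qed.

Lemma base2_mul t u s : mul2 t u = Some s -> forall x,
  wmove base2 [:: t; u] x = wmove base2 s x /\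
  red (@free_mul bool) (wout base2 [:: t; u] x) =
    red (@free_mul bool) (wout base2 s x).
Proof. by case: t u => [] [] //= [<-]; apply: ord2_ind. Qed.

(* [yA] and [yB] are the inverses of [ya] and [yb]. *)
Inductive letter3 := ya | yA | yb | yB.

Definition inv3 (t : letter3) := match t with ya => yA | yA => ya | yb => yB | yB => yb end.

Definition mul3 (t u : letter3) : option (seq letter3) :=
  match t, u with
  | ya, ya => Some [:: yA] | yA, yA => Some [:: ya]
  | yb, yb => Some [:: yB] | yB, yB => Some [:: yb]
  | ya, yA | yA, ya | yb, yB | yB, yb => Some [::]
  | _, _ => None end.

(* [yb] has outputs x, y, (yx)^-1 around the cycle, so that its cube is trivial. *)
Definition base3_out (t : letter3) (x : 'I_3) : seq (bool * bool) :=
  match t, val x with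
  | yb, 0 => [:: (true, true)] | yb, 1 => [:: (false, true)]
  | yb, _ => [:: (true, false); (false, false)]
  | yB, 0 => [:: (false, true); (true, true)] | yB, 1 => [:: (true, false)]
  | yB, _ => [:: (false, false)]
  | _, _ => [::] end.

(** Both generators advance the cycle, so point stabilisers are the kernel of the map from $Z/3 *
    Z/3$ to $Z/3$ sending both to 1, which is free of rank 2. *)
Definition base3_move (t : letter3) := match t with ya | yb => next3 | _ => prev3 end.

Lemma base3_inj t : injective (base3_move t).
Proof. by case: t; first [exact: can_inj next3K | exact: can_inj prev3K]. Qed.

Definition base3 := Transducer base3_out base3_inj.

Lemma base3_replicates g : exists w,
  wmove base3 w ord0 = ord0 /\ red (@free_mul bool) (wout base3 w ord0) = [:: g].
Proof.
(* [ya] emits nothing, so its powers select which output of [yb] or [yB] is read. *)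
by case: g => [[] []]; [exists [:: yA; yb] | exists [:: yB; ya] |
  exists [:: ya; yb; ya] | exists [:: yA; yB; yA]]; split=> //; apply: val_inj.
Qed.

Lemma base3_mul t u s : mul3 t u = Some s -> forall x,
  wmove base3 [:: t; u] x = wmove base3 s x /\
  red (@free_mul bool) (wout base3 [:: t; u] x) =
    red (@free_mul bool) (wout base3 s x).
Proof. by case: t u => [] [] //= [<-]; apply: ord3_ind. Qed.

Lemma letter2_bound (N : letter2 -> nat) : exists M, forall t, N t <= M.
Proof.
exists (maxn (N xa) (maxn (N xb) (N xc))).
by case; rewrite !leq_max leqnn ?orbT.
Qed.

Lemma letter3_bound (N : letter3 -> nat) : exists M, forall t, N t <= M.
Proof.
exists (maxn (maxn (N ya) (N yA)) (maxn (N yb) (N yB))).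
by case; rewrite !leq_max leqnn ?orbT.
Qed.

(** * The wreath recursions of the four groups *)

Definition J_move (t : letter2) : 'I_2 -> 'I_2 := if t is xa then swap2 else id.

Definition J_out (t : letter2) (x : 'I_2) : seq letter2 :=
  match t, val x with
  | xb, 0 => [:: xa] | xb, _ => [:: xc] | xc, 0 => [:: xb] | _, _ => [::] end.

Lemma J_inj t : injective (J_move t).
Proof. by case: t => //=; exact: inv_inj swap2K. Qed.

Definition J_cover : cover J_aut.
Proof.
(* The [1] stands for Sym(2), since [base] has degree [base_deg.+1]. *)
refine (@Cover J_aut letter2 id mul2 (Transducer J_out J_inj) (ord2 0) 1 base2
  (fun q : J_st => match q with J1 => [::] | Ja => [:: xa] | Jb => [:: xb] | Jc => [:: xc] end)
  (fun s : J_gen => match s with Jga => xa | Jgb => xb | Jgc => xc end)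
  letter2_bound _ _ base2_mul _ _ _ _ base2_replicates _ _ _).
- by case.
- by case=> [] [] //= s [<-]; apply: ord2_ind.
- by case; apply: ord2_ind.
(* The product $bc$ shows why [contract] takes two levels: its section at 0 is $ab$, still of length
   2, whose sections are $a$ and $c$. *)
- by move=> t u; apply: ord2_ind; apply: ord2_ind; case: t u => [] [].
(* On 000, $a$ moves the first letter, $b$ the second through its section $a$, and $c$ the third
   through its section $b$. *)
- by case; exists [:: ord2 0; ord2 0; ord2 0].
- by case; [exists [:: xb] | exists [:: xc] | exists [:: xa; xb; xa]].
- by case; apply: ord2_ind => /=; rewrite ?tau01E ?perm1.
- by case.
- by case; [exists (Jga, false) | exists (Jgb, false) | exists (Jgc, false)].
Defined.

Definition H_move (t : letter2) (x : 'I_3) : 'I_3 :=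
  match t, val x with
  | xa, 0 => ord3 0 | xa, 1 => ord3 2 | xa, _ => ord3 1
  | xb, 0 => ord3 2 | xb, 1 => ord3 1 | xb, _ => ord3 0
  | xc, 0 => ord3 1 | xc, 1 => ord3 0 | xc, _ => ord3 2 end.

Definition H_out (t : letter2) (x : 'I_3) : seq letter2 :=
  match t, val x with
  | xa, 0 => [:: xa] | xb, 1 => [:: xb] | xc, 2 => [:: xc] | _, _ => [::] end.

Lemma H_moveK t : involutive (H_move t).
Proof. by case: t; apply: ord3_ind. Qed.

Lemma inord3E i : i < 3 -> inord i = ord3 i.
Proof. by case: i => [|[|[|//]]] lt_i; apply: val_inj; rewrite /= inordK. Qed.

Lemma t12E x : t12 x = H_move xa x.
Proof.
by rewrite /t12 !inord3E //; elim/ord3_ind: x; apply: val_inj; rewrite permE.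
Qed.

Lemma t02E x : t02 x = H_move xb x.
Proof.
by rewrite /t02 !inord3E //; elim/ord3_ind: x; apply: val_inj; rewrite permE.
Qed.

Lemma t01E x : t01 x = H_move xc x.
Proof.
by rewrite /t01 !inord3E //; elim/ord3_ind: x; apply: val_inj; rewrite permE.
Qed.

Definition H_cover : cover H_aut.
Proof.
refine (@Cover H_aut letter2 id mul2
  (Transducer H_out (fun t => inv_inj (H_moveK t))) (ord3 0) 1 base2
  (fun q : H_st => match q with H1 => [::] | Ha => [:: xa] | Hb => [:: xb] | Hc => [:: xc] end)
  (fun s : H_gen => match s with Hga => xa | Hgb => xb | Hgc => xc end)
  letter2_bound _ _ base2_mul _ _ _ _ base2_replicates _ _ _).
- by case.
- by case=> [] [] //= s [<-]; apply: ord3_ind.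
- by case; apply: ord3_ind.
- by case=> [] []; apply: ord3_ind; apply: ord3_ind.
- by case; exists [:: ord3 0; ord3 1].
(* Conjugating by a generator with empty outputs along the way brings the sections $b$ at 1 and $c$
   at 2 to the vertex 0. *)
- by case; [exists [:: xa] | exists [:: xc; xb; xc] | exists [:: xb; xc; xb]].
- by case; apply: ord3_ind => /=; rewrite ?t12E ?t02E ?t01E ?perm1.
- by case.
- by case; [exists (Hga, false) | exists (Hgb, false) | exists (Hgc, false)].
Defined.

Definition Z3_move (t : letter3) : 'I_3 -> 'I_3 :=
  match t with ya => next3 | yA => prev3 | _ => id end.

Lemma Z3_inj t : injective (Z3_move t).
Proof. by case: t => //=; [exact: can_inj next3K | exact: can_inj prev3K]. Qed.

Definition FG_out (t : letter3) (x : 'I_3) : seq letter3 :=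
  match t, val x with
  | yb, 0 => [:: ya] | yB, 0 => [:: yA]
  | yb, 2 => [:: yb] | yB, 2 => [:: yB]
  | _, _ => [::] end.

Definition FG_cover : cover FG_aut.
Proof.
refine (@Cover FG_aut letter3 inv3 mul3 (Transducer FG_out Z3_inj) (ord3 2) 2 base3
  (fun q : FG_st => match q with FG1 => [::] | FGa => [:: ya] | FGb => [:: yb] end)
  (fun s : FG_gen => match s with FGga => ya | FGgb => yb end)
  letter3_bound _ _ base3_mul _ _ _ _ base3_replicates _ _ _).
- by case.
- by case=> [] [] //= s [<-]; apply: ord3_ind.
- by case; apply: ord3_ind.
- by case=> [] []; apply: ord3_ind; apply: ord3_ind.
- by case; exists [:: ord3 0; ord3 0].
(* At the vertex 2, [yb] has itself as section; conjugating it by [ya] brings there its section [ya]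
   from 0. *)
- by case; [exists [:: yA; yb; ya] | exists [:: yA; yB; ya] |
    exists [:: yb] | exists [:: yB]].
- by case; apply: ord3_ind => /=; rewrite ?tau_cycE ?perm1.
- by case.
- by case; [exists (FGga, false) | exists (FGga, true) |
    exists (FGgb, false) | exists (FGgb, true)].
Defined.

Definition GS_out (t : letter3) (x : 'I_3) : seq letter3 :=
  match t, val x with
  | yb, 0 => [:: ya] | yB, 0 => [:: yA]
  | yb, 1 => [:: yA] | yB, 1 => [:: ya]
  | yb, _ => [:: yb] | yB, _ => [:: yB]
  | _, _ => [::] end.

Definition GS_cover : cover GS_aut.
Proof.
(* The state [GSai] becomes the letter [yA], so the section of [GSb] at 1 is again a single
   letter. *)
refine (@Cover GS_aut letter3 inv3 mul3 (Transducer GS_out Z3_inj) (ord3 2) 2 base3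
  (fun q : GS_st =>
     match q with GS1 => [::] | GSa => [:: ya] | GSai => [:: yA] | GSb => [:: yb] end)
  (fun s : GS_gen => match s with GSga => ya | GSgb => yb end)
  letter3_bound _ _ base3_mul _ _ _ _ base3_replicates _ _ _).
- by case.
- by case=> [] [] //= s [<-]; apply: ord3_ind.
- by case; apply: ord3_ind.
- by case=> [] []; apply: ord3_ind; apply: ord3_ind.
- by case; exists [:: ord3 0; ord3 0].
- by case; [exists [:: yA; yb; ya] | exists [:: yA; yB; ya] |
    exists [:: yb] | exists [:: yB]].
- by case; apply: ord3_ind => /=; rewrite ?tau_cycE ?tau_cycVE ?perm1.
- by case.
- by case; [exists (GSga, false) | exists (GSga, true) |
    exists (GSgb, false) | exists (GSgb, true)].
Defined.

Theorem mainTheorem10 (g : which_group) (G : Grp) :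
  finitely_presented G -> epi_onto G (automaton_of g) -> large G.
Proof.
by case: g; apply: large_of_epi_onto;
  [exact: J_cover | exact: GS_cover | exact: FG_cover | exact: H_cover].
Qed.
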